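(* Let $\mathbf{k}$ be a commutative ring with unit, $X$ a set and $\Omega$ a semigroup. Then $(\mathrm{DT}(X,\Omega),\{\prec_\omega,\succ_\omega\mid\omega\in\Omega\},\cdot)$, the $\mathbf{k}$-module spanned by the $X$-valently decorated $\Omega$-typed Schröder trees with at least two leaves, endowed with the operations defined recursively in the context, is a tridendriform family algebra, generated by the set $\{\bigvee_{x}^{2;\,1,1}(|,|)\ :\ x\in X\}$ of trees with two leaves.
   Context: All binary operations on $\mathbf{k}$-modules are $\mathbf{k}$-bilinear. Tridendriform family algebra: a $\mathbf{k}$-module $T$ with binary operations $\{\prec_\omega,\succ_\omega\mid\omega\in\Omega\}$ and a binary operation $\cdot$ such that for all $x,y,z\in T$ and $\alpha,\beta\in\Omega$: $(x\prec_\alpha y)\prec_\beta z=x\prec_{\alpha\beta}(y\prec_\beta z+y\succ_\alpha z+y\cdot z)$; $(x\succ_\alpha y)\prec_\beta z=x\succ_\alpha(y\prec_\beta z)$; $(x\prec_\beta y+x\succ_\alpha y+x\cdot y)\succ_{\alpha\beta}z=x\succ_\alpha(y\succ_\beta z)$; $(x\succ_\alpha y)\cdot z=x\succ_\alpha(y\cdot z)$; $(x\prec_\alpha y)\cdot z=x\cdot(y\succ_\alpha z)$; $(x\cdot y)\prec_\alpha z=x\cdot(y\prec_\alpha z)$; $(x\cdot y)\cdot z=x\cdot(y\cdot z)$. It is generated by a subset $S$ if it is the smallest $\mathbf{k}$-submodule containing $S$ and closed under all $\prec_\omega,\succ_\omega$ and $\cdot$. Monoid $\Omega^1$: if $\Omega$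 has no identity element, $\Omega^1:=\Omega\sqcup\{1\}$ with $1\omega=\omega1=\omega$ and $11=1$; if $\Omega$ has an identity, $\Omega^1:=\Omega$ and $1$ denotes its identity. Trees: a Schröder tree is a reduced planar rooted tree (every internal vertex has at least two incoming edges; its arity is the number of incoming edges). For $n\ge0$, $T_n$ is the set of Schröder trees with $n+1$ leaves in which every internal vertex of arity $k+1$ is decorated by an element of $X^k$, every internal edge (edge joining two internal vertices; neither a leaf nor the root edge) is decorated by an element of $\Omega$, and leaves are decorated by $1\in\Omega^1$. $T_0=\{|\}$, where $|$ has one leaf and no internal vertex. For trees $T^{(0)},\dots,T^{(k)}$ ($k\ge1$), $x_1,\dots,x_k\in X$ and $\alpha_0,\dots,\alpha_k\in\Omega^1$ (with $\alpha_i=1$ if $T^{(i)}=|$ and $\alpha_i\in\Omega$ otherwise), the grafting $\bigvee_{x_1,\dots,x_k}^{k+1;\,\alpha_0,\dots,\alpha_k}(T^{(0)},\dots,T^{(k)})$ is the tree obtained by joining the roots of $T^{(0)},\dots,T^{(k)}$, from left to right, to a new vertex decorated by $(x_1,\dots,x_k)$, the new edges being decorated from left to right by $\alpha_0,\dots,\alpha_k$. Every tree other than $|$ is uniquely such a grafting. The depth $\mathrm{dep}(T)$ is the maximal number of internal vertices on a path from the root to a leaf ($\mathrm{dep}(|)=0$). Grafting is extended multilinearly. $\mathrm{DT}(X,\Omega):=\bigoplus_{n\ge1}\mathbf{k}T_n$. The bilinear operations $\prec_\omega,\succ_\omega$ ($\omega\in\Omega$) and $\cdot$ are defined recursively on $\mathrm{dep}(T)+\mathrm{dep}(U)$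 by: (a) for $\omega\in\Omega$ and $T\in T_n$ with $n\ge1$: $|\succ_\omega T:=T\prec_\omega|:=T$, $|\prec_\omega T:=T\succ_\omega|:=0$ and $|\cdot T:=T\cdot|:=0$; likewise for $\omega=1\in\Omega^1$: $|\succ_1T:=T\prec_1|:=T$, $|\prec_1T:=T\succ_1|:=0$; moreover $|\prec_1|+|\succ_1|+|\cdot|:=|$; (b) for $T=\bigvee_{x_1,\dots,x_m}^{m+1;\,\alpha_0,\dots,\alpha_m}(T^{(0)},\dots,T^{(m)})$ and $U=\bigvee_{y_1,\dots,y_n}^{n+1;\,\beta_0,\dots,\beta_n}(U^{(0)},\dots,U^{(n)})$: $$T\prec_\omega U:=\bigvee\nolimits_{x_1,\dots,x_m}^{m+1;\,\alpha_0,\dots,\alpha_{m-1},\alpha_m\omega}\bigl(T^{(0)},\dots,T^{(m-1)},\,T^{(m)}\succ_{\alpha_m}U+T^{(m)}\prec_\omega U+T^{(m)}\cdot U\bigr),$$ $$T\succ_\omega U:=\bigvee\nolimits_{y_1,\dots,y_n}^{n+1;\,\omega\beta_0,\beta_1,\dots,\beta_n}\bigl(T\succ_\omega U^{(0)}+T\prec_{\beta_0}U^{(0)}+T\cdot U^{(0)},\,U^{(1)},\dots,U^{(n)}\bigr),$$ $$T\cdot U:=\bigvee\nolimits_{x_1,\dots,x_m,y_1,\dots,y_n}^{m+n+1;\,\alpha_0,\dots,\alpha_{m-1},\alpha_m\beta_0,\beta_1,\dots,\beta_n}\bigl(T^{(0)},\dots,T^{(m-1)},\,T^{(m)}\succ_{\alpha_m}U^{(0)}+T^{(m)}\prec_{\beta_0}U^{(0)}+T^{(m)}\cdot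 U^{(0)},\,U^{(1)},\dots,U^{(n)}\bigr).$$ *)

(* Defs.v *)
From HB Require Import structures.
From mathcomp Require Import all_boot all_algebra finmap.
From mathcomp Require Import boolp classical_sets.
From mathcomp Require Import monalg.

Set Implicit Arguments.
Unset Strict Implicit.
Unset Printing Implicit Defensive.

Import GRing.Theory.

Local Open Scope ring_scope.

(* {malg k[K]} is only declared an lmodType for a nontrivial k; the alias
   [free] carries the module structure over an arbitrary (possibly zero)
   commutative ring. *)
Definition free (k : comPzRingType) (K : choiceType) : Type := {malg k[K]}.

Section FreeModule.
Variables (k : comPzRingType) (K : choiceType).

HB.instance Definition _ := GRing.Zmodule.copy (free k K) {malg k[K]}.

Definition fscale (c : k) (g : free k K) : free k K :=
  [malg t in msupp g => c * g@_t].

Lemma fscaleE c g t : (fscale c g)@_t = c * g@_t.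
Proof. by rewrite mcoeffE; case: msuppP; rewrite ?mulr0. Qed.

Lemma fscaleA c d g : fscale c (fscale d g) = fscale (c * d) g.
Proof. by apply/malgP => t; rewrite !fscaleE mulrA. Qed.

Lemma fscale1 : left_id 1 fscale.
Proof. by move=> g; apply/malgP => t; rewrite fscaleE mul1r. Qed.

Lemma fscaleDr : right_distributive fscale +%R.
Proof.
by move=> c g h; apply/malgP => t; rewrite mcoeffD !fscaleE mcoeffD mulrDr.
Qed.

Lemma fscaleDl g : {morph fscale^~ g : c d / c + d}.
Proof. by move=> c d; apply/malgP => t; rewrite mcoeffD !fscaleE mulrDl. Qed.

HB.instance Definition _ := GRing.Zmodule_isLmodule.Build k (free k K)
  fscaleA fscale1 fscaleDr fscaleDl.

Definition basis (t : K) : free k K := << t >>.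

Definition lin (M : lmodType k) (f : K -> M) (g : free k K) : M :=
  \sum_(t <- msupp g) g@_t *: f t.

Definition bilin (M : lmodType k) (f : K -> K -> M) (g h : free k K) : M :=
  lin (fun t => lin (f t) h) g.

Definition supported (P : pred K) : {pred free k K} :=
  fun g => all P (msupp g).

Lemma supportedP (P : pred K) (g : free k K) :
  reflect (forall t, ~~ P t -> g@_t = 0) (g \in supported P).
Proof.
apply: (iffP allP) => [Pg t Pt|Pg t].
  by apply: mcoeff_outdom; apply: contra Pt; apply: Pg.
by rewrite -mcoeff_neq0; apply: contraR => /Pg->.
Qed.

Lemma supported_submod (P : pred K) : submod_closed (supported P).
Proof.
split=> [|c g h /supportedP Pg /supportedP Ph]; apply/supportedP => t Pt.
  by rewrite mcoeff0.
by rewrite mcoeffD fscaleE Pg // Ph // mulr0 addr0.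
Qed.

HB.instance Definition _ (P : pred K) :=
  GRing.isSubmodClosed.Build k (free k K) (supported P) (supported_submod P).

Lemma supported_basis (P : pred K) t : P t -> basis t \in supported P.
Proof.
move=> Pt; apply/supportedP => u Pu; rewrite mcoeffU.
by case: eqP Pu => // <-; rewrite Pt.
Qed.

End FreeModule.

Lemma supported_lin (k : comPzRingType) (K K' : choiceType) (P : pred K)
    (Q : pred K') (f : K -> free k K') g :
  (forall t, P t -> f t \in supported Q) -> g \in supported P ->
  lin f g \in supported Q.
Proof.
move=> Qf /allP Pg; rewrite /lin big_seq rpred_sum // => t /Pg Pt.
by rewrite rpredZ ?Qf.
Qed.

(* The monoid Omega^1: the adjoined unit is available only when Omega has no
   identity element; it is unique by proof irrelevance. *)
Section Unitization.
Variable Omega : semigroupType.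

Definition is_identity (e : Omega) : Prop :=
  forall w : Omega, (e * w)%g = w /\ (w * e)%g = w.

Inductive unitization : Type :=
| InO of Omega
| Adjoined of ~ (exists e, is_identity e).

Definition one1 : unitization :=
  match pselect (exists e, is_identity e) with
  | left h => InO (sval (cid h))
  | right h => Adjoined h
  end.

Definition mul1 (a b : unitization) : unitization :=
  match a, b with
  | InO v, InO w => InO (v * w)%g
  | Adjoined _, _ => b
  | _, Adjoined _ => a
  end.

Definition inO (a : unitization) : bool := if a is InO _ then true else false.

Lemma mul1A : associative mul1.
Proof. by move=> [a|?] [b|?] [c|?] //=; rewrite mulgA. Qed.

Lemma mul1o a : mul1 one1 a = a.
Proof.
rewrite /one1; case: pselect => // h; case: a => [w|//] /=.
by case: cid => e /= /(_ w)[->].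
Qed.

Lemma mulo1 a : mul1 a one1 = a.
Proof.
rewrite /one1; case: pselect => h; last first.
  by case: a => //= h'; congr Adjoined; apply: Prop_irrelevance.
by case: a => [w|//] /=; case: cid => e /= /(_ w)[_ ->].
Qed.

End Unitization.
Arguments Adjoined {Omega} _.
Arguments one1 {Omega}.

(* [Graft [:: x_1; ...; x_k] [:: (a_0, T_0); ...; (a_k, T_k)]] is the grafting
   of T_0, ..., T_k. Raw trees are unconstrained; [well_decorated] below selects
   the Schroeder trees with admissible decorations. *)
Inductive rtree (X : Type) (Omega : semigroupType) : Type :=
| Leaf
| Graft of seq X & seq (unitization Omega * rtree X Omega).
Arguments Leaf {X Omega}.

HB.instance Definition _ (X : Type) (Omega : semigroupType) :=
  gen_eqMixin (rtree X Omega).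
HB.instance Definition _ (X : Type) (Omega : semigroupType) :=
  gen_choiceMixin (rtree X Omega).

Section Trees.
Variables (X : Type) (Omega : semigroupType).
Local Notation tree := (rtree X Omega).
Local Notation edge := (unitization Omega * tree)%type.

Definition is_leaf (T : tree) : bool := if T is Leaf then true else false.

Fixpoint leaves (T : tree) : nat :=
  match T with
  | Leaf => 1
  | Graft _ bs => sumn [seq leaves b.2 | b <- bs]
  end.

Fixpoint depth (T : tree) : nat :=
  match T with
  | Leaf => 0
  | Graft _ bs => (foldr (fun b d => maxn (depth b.2) d) 0 bs).+1
  end.

Definition edge_ok (b : edge) : bool :=
  if is_leaf b.2 then `[< b.1 = one1 >] else inO b.1.

Fixpoint well_decorated (T : tree) : bool :=
  match T with
  | Leaf => true
  | Graft xs bs =>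
      [&& 0 < size xs, size bs == (size xs).+1 &
          all (fun b => edge_ok b && well_decorated b.2) bs]
  end%N.

(* the disjoint union of the sets T_n (trees with n + 1 leaves) for n >= 1 *)
Definition DT_tree : pred tree :=
  fun T => well_decorated T && (2 <= leaves T)%N.

Definition first_edge (bs : seq edge) : edge := head (one1, Leaf) bs.
Definition last_edge (bs : seq edge) : edge := last (one1, Leaf) bs.
Definition but_last (bs : seq edge) : seq edge := take (size bs).-1 bs.

Definition corolla (x : X) : tree :=
  Graft [:: x] [:: (one1, Leaf); (one1, Leaf)].

End Trees.

Section Operations.
Variables (k : comPzRingType) (X : Type) (Omega : semigroupType).
Local Notation tree := (rtree X Omega).
Local Notation edge := (unitization Omega * tree)%type.
Local Notation FT := (free k tree).

Definition graft_at (xs : seq X) (l : seq edge) (a : unitization Omega) (S : FT)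
    (r : seq edge) : FT :=
  lin (fun V => basis k (Graft xs (l ++ (a, V) :: r))) S.

(* The recursion meets |-clauses indexed by 1 in Omega^1, hence the indices in
   [unitization Omega]; only indices in Omega act on [DT] below. *)
Inductive operation :=
| Prec of unitization Omega
| Succ of unitization Omega
| Dot.

(* T succ_a U + T prec_b U + T . U, where the individual terms are undefined for
   T = U = | but their sum is |. *)
Definition total (op : operation -> tree -> tree -> FT)
    (a : unitization Omega) (T : tree) (b : unitization Omega) (U : tree) : FT :=
  if is_leaf T && is_leaf U then basis k Leaf
  else op (Succ a) T U + op (Prec b) T U + op Dot T U.

(* [n] bounds the recursion on depth T + depth U; the recursive equations, free
   of [n], are [prec_graft], [succ_graft] and [dot_graft]. The value on the pair
   (|, |) is a dummy, never used by [total]. *)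
Fixpoint op_rec (n : nat) (o : operation) (T U : tree) {struct n} : FT :=
  match T, U with
  | Leaf, Leaf => 0
  | Leaf, Graft _ _ => if o is Succ _ then basis k U else 0
  | Graft _ _, Leaf => if o is Prec _ then basis k T else 0
  | Graft xs bs, Graft ys cs =>
      if n is n'.+1 then
        let: (am, Tm) := last_edge bs in
        let: (b0, U0) := first_edge cs in
        match o with
        | Prec w =>
            graft_at xs (but_last bs) (mul1 am w)
              (total (op_rec n') am Tm w U) [::]
        | Succ w =>
            graft_at ys [::] (mul1 w b0)
              (total (op_rec n') w T b0 U0) (behead cs)
        | Dot =>
            graft_at (xs ++ ys) (but_last bs) (mul1 am b0)
              (total (op_rec n') am Tm b0 U0) (behead cs)
        end
      else 0
  end.

Definition op (o : operation) (T U : tree) : FT :=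
  op_rec (depth T + depth U) o T U.

Lemma leaf_prec w T : ~~ is_leaf T -> op (Prec w) Leaf T = 0.
Proof. by case: T. Qed.

Lemma prec_leaf w T : ~~ is_leaf T -> op (Prec w) T Leaf = basis k T.
Proof. by case: T => // xs bs _; rewrite /op /= addn0. Qed.

Lemma leaf_succ w T : ~~ is_leaf T -> op (Succ w) Leaf T = basis k T.
Proof. by case: T. Qed.

Lemma succ_leaf w T : ~~ is_leaf T -> op (Succ w) T Leaf = 0.
Proof. by case: T => // xs bs _; rewrite /op /= addn0. Qed.

Lemma leaf_dot T : ~~ is_leaf T -> op Dot Leaf T = 0.
Proof. by case: T. Qed.

Lemma dot_leaf T : ~~ is_leaf T -> op Dot T Leaf = 0.
Proof. by case: T => // xs bs _; rewrite /op /= addn0. Qed.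

Lemma depth_last (xs : seq X) (bs : seq edge) :
  (depth (last_edge bs).2 < depth (Graft xs bs))%N.
Proof.
rewrite ltnS; elim: bs => //= b [|b' bs] IH /=; first by rewrite maxn0.
by rewrite (leq_trans IH) ?leq_maxr.
Qed.

Lemma depth_first (ys : seq X) (cs : seq edge) :
  (depth (first_edge cs).2 < depth (Graft ys cs))%N.
Proof. by rewrite ltnS; case: cs => //= b cs; rewrite leq_maxl. Qed.

Lemma eq_total f g a T b U :
  (forall o, f o T U = g o T U) -> total f a T b U = total g a T b U.
Proof. by move=> fg; rewrite /total !fg. Qed.

Lemma op_rec_stable n m o T U :
  (depth T + depth U <= n)%N -> (depth T + depth U <= m)%N ->
  op_rec n o T U = op_rec m o T U.
Proof.
elim: n m o T U => [|n IHn] [|m] o [|xs bs] [|ys cs] // len lem.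
have step V W : (depth V + depth W < depth (Graft xs bs) + depth (Graft ys cs))%N ->
    forall o, op_rec n o V W = op_rec m o V W.
  by move=> lt o'; apply: IHn; rewrite -ltnS; apply: leq_trans lt _.
have dl := depth_last xs bs; have df := depth_first ys cs.
rewrite /op_rec -/op_rec.
case: (last_edge bs) dl => am Tm dl; case: (first_edge cs) df => b0 U0 df.
case: o => [w|w|]; congr graft_at; apply: eq_total; apply: step.
- by rewrite ltn_add2r.
- by rewrite ltn_add2l.
- exact: leq_trans (leq_add dl (ltnW df)).
Qed.

Lemma op_graft o xs bs ys cs :
  op o (Graft xs bs) (Graft ys cs) =
  let: (am, Tm) := last_edge bs in
  let: (b0, U0) := first_edge cs in
  match o with
  | Prec w =>
      graft_at xs (but_last bs) (mul1 am w)
        (total op am Tm w (Graft ys cs)) [::]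
  | Succ w =>
      graft_at ys [::] (mul1 w b0)
        (total op w (Graft xs bs) b0 U0) (behead cs)
  | Dot =>
      graft_at (xs ++ ys) (but_last bs) (mul1 am b0)
        (total op am Tm b0 U0) (behead cs)
  end.
Proof.
have [d dE] : exists d, d = (depth (Graft xs bs) + depth (Graft ys cs))%N.
  by eexists.
rewrite {1}/op (@op_rec_stable _ d.+1) ?dE // -dE.
have step V W : (depth V + depth W < depth (Graft xs bs) + depth (Graft ys cs))%N ->
    forall o, op_rec d o V W = op o V W.
  by rewrite -dE => lt o'; apply: op_rec_stable => //; apply: ltnW.
have dl := depth_last xs bs; have df := depth_first ys cs.
rewrite /op_rec -/op_rec.
case: (last_edge bs) dl => am Tm dl; case: (first_edge cs) df => b0 U0 df.
case: o => [w|w|]; congr graft_at; apply: eq_total; apply: step.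
- by rewrite ltn_add2r.
- by rewrite ltn_add2l.
- exact: leq_trans (leq_add dl (ltnW df)).
Qed.

Lemma prec_graft w xs bs am Tm U : ~~ is_leaf U ->
  op (Prec w) (Graft xs (rcons bs (am, Tm))) U =
  graft_at xs bs (mul1 am w) (total op am Tm w U) [::].
Proof.
case: U => // ys cs _; rewrite op_graft /last_edge /but_last last_rcons.
by case: first_edge => b0 U0; rewrite size_rcons -cats1 take_size_cat.
Qed.

Lemma succ_graft w T ys b0 U0 cs : ~~ is_leaf T ->
  op (Succ w) T (Graft ys ((b0, U0) :: cs)) =
  graft_at ys [::] (mul1 w b0) (total op w T b0 U0) cs.
Proof.
by case: T => // xs bs _; rewrite op_graft /=; case: last_edge => am Tm.
Qed.

Lemma dot_graft xs bs am Tm ys b0 U0 cs :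
  op Dot (Graft xs (rcons bs (am, Tm))) (Graft ys ((b0, U0) :: cs)) =
  graft_at (xs ++ ys) bs (mul1 am b0) (total op am Tm b0 U0) cs.
Proof.
rewrite op_graft /last_edge /but_last last_rcons /=.
by rewrite size_rcons -cats1 take_size_cat.
Qed.

End Operations.
Arguments Dot {Omega}.

Section Closure.
Variables (k : comPzRingType) (X : Type) (Omega : semigroupType).
Local Notation tree := (rtree X Omega).
Local Notation edge := (unitization Omega * tree)%type.
Local Notation FT := (free k tree).

Lemma rtree_nested_ind (P : tree -> Prop) :
  P Leaf ->
  (forall xs bs, foldr (fun b Q => P b.2 /\ Q) True bs -> P (Graft xs bs)) ->
  forall T, P T.
Proof.
move=> PL PG; fix IH 1 => -[|xs bs]; first exact: PL.
apply: PG; elim: bs => [|b bs IHbs]; first by [].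
by split; [apply: IH|apply: IHbs].
Qed.

Lemma leaves_gt0 (T : tree) : well_decorated T -> (0 < leaves T)%N.
Proof.
elim/rtree_nested_ind: T => //= xs [_ /and3P[] //|b bs [IHb _] /and3P[_ _] /=].
by case/andP=> /andP[_ /IHb lt0] _; rewrite addn_gt0 lt0.
Qed.

Lemma DT_treeE (T : tree) : DT_tree T = well_decorated T && ~~ is_leaf T.
Proof.
rewrite /DT_tree; case: T => [|xs bs] //; rewrite [RHS]andbT.
case wT: well_decorated => //=.
move: wT => /= /and3P[]; case: xs => // x xs _.
case: bs => [|b [|c bs]] //= _.
case/andP=> /andP[_ wb] /andP[/andP[_ wc] _].
by rewrite addnA; apply: leq_trans (leq_add (leaves_gt0 wb) (leaves_gt0 wc)) (leq_addr _ _).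
Qed.

Definition ok_edge (b : edge) : bool := edge_ok b && well_decorated b.2.

Lemma ok_edge_DT w (T : tree) : DT_tree T -> ok_edge (InO w, T).
Proof.
by rewrite DT_treeE /ok_edge /edge_ok /= => /andP[-> /negbTE->].
Qed.

Definition in_Omega_op (o : operation Omega) : bool :=
  match o with Prec w | Succ w => inO w | Dot => true end.

Lemma supported_total (f : operation Omega -> tree -> tree -> FT) a T b U :
  (forall o, in_Omega_op o -> DT_tree T -> DT_tree U ->
     f o T U \in supported (@DT_tree X Omega)) ->
  (forall w, ~~ is_leaf U -> f (Prec w) Leaf U = 0) ->
  (forall w, ~~ is_leaf U -> f (Succ w) Leaf U = basis k U) ->
  (~~ is_leaf U -> f Dot Leaf U = 0) ->
  (forall w, ~~ is_leaf T -> f (Prec w) T Leaf = basis k T) ->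
  (forall w, ~~ is_leaf T -> f (Succ w) T Leaf = 0) ->
  (~~ is_leaf T -> f Dot T Leaf = 0) ->
  ok_edge (a, T) -> ok_edge (b, U) ->
  total f a T b U \in supported (fun V => ok_edge (mul1 a b, V)).
Proof.
move=> fDT pl sl dl pr sr dr okT okU.
have [Tl|Tn] := boolP (is_leaf T); have [Ul|Un] := boolP (is_leaf U).
- case: T Tl okT {fDT pr sr dr} => // _ okT; case: U Ul okU {pl sl dl} => // _ okU.
  apply: supported_basis.
  move: okT okU; rewrite /ok_edge /edge_ok /= !andbT => /asboolP-> /asboolP->.
  by apply/asboolP; rewrite mul1o.
- case: T Tl okT {fDT pr sr dr} => // _; rewrite /ok_edge /edge_ok /= andbT.
  move=> /asboolP->; rewrite /total /= (negbTE Un) sl // pl // dl // !addr0 mul1o.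
  exact: supported_basis.
- case: U Ul okU {fDT pl sl dl} => // _; rewrite /ok_edge /edge_ok /= andbT.
  move=> /asboolP->; rewrite /total andbT (negbTE Tn) sr // pr // dr //.
  by rewrite add0r addr0 mulo1; apply: supported_basis.
have DTT : DT_tree T by rewrite DT_treeE Tn; case/andP: okT => _ ->.
have DTU : DT_tree U by rewrite DT_treeE Un; case/andP: okU => _ ->.
have [v av] : exists v, a = InO v.
  by case: a okT => [v|n]; [exists v|rewrite /ok_edge /edge_ok /= (negbTE Tn)].
have [w bw] : exists w, b = InO w.
  by case: b okU => [w|n]; [exists w|rewrite /ok_edge /edge_ok /= (negbTE Un)].
have sub g : g \in supported (@DT_tree X Omega) ->
    g \in supported (fun V => ok_edge (mul1 a b, V)).
  move=> /supportedP gDT; apply/supportedP => V; apply: contraNeq => gV.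
  rewrite av bw; apply: ok_edge_DT; apply: contraNT gV => /gDT ->; exact: eqxx.
rewrite /total (negbTE Tn) /= av bw; rewrite av bw in sub.
by rewrite !rpredD //; apply: sub; apply: fDT.
Qed.

Lemma supported_graft_at xs (l : seq edge) a (S : FT) r :
  (0 < size xs)%N -> size xs = (size l + size r)%N ->
  all ok_edge l -> all ok_edge r ->
  S \in supported (fun V => ok_edge (a, V)) ->
  graft_at xs l a S r \in supported (@DT_tree X Omega).
Proof.
move=> xs0 sz okl okr; apply: supported_lin => V okV.
apply: supported_basis; rewrite DT_treeE andbT /= xs0 size_cat /= addnS sz eqxx.
by rewrite all_cat /= -[_ && _ in X in _ && (X && _)]/(ok_edge (a, V)) okV okl.
Qed.

Lemma supported_op_rec n o T U :
  in_Omega_op o -> DT_tree T -> DT_tree U ->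
  op_rec k n o T U \in supported (@DT_tree X Omega).
Proof.
elim: n o T U => [|n IHn] o [|xs bs] [|ys cs] // oO DTT DTU; first exact: rpred0.
have tot a V b W : ok_edge (a, V) -> ok_edge (b, W) ->
    total (op_rec k n) a V b W \in supported (fun V => ok_edge (mul1 a b, V)).
  apply: supported_total.
  - by move=> o' ? ? ?; apply: IHn.
  - by case: W; case: n {IHn}.
  - by case: W; case: n {IHn}.
  - by case: W; case: n {IHn}.
  - by case: V; case: n {IHn}.
  - by case: V; case: n {IHn}.
  - by case: V; case: n {IHn}.
have okT w : inO w -> ok_edge (w, Graft xs bs) by case: w => // w _; apply: ok_edge_DT.
have okU w : inO w -> ok_edge (w, Graft ys cs) by case: w => // w _; apply: ok_edge_DT.
move: DTT DTU; rewrite !DT_treeE !andbT.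
move=> /and3P[xs0 /eqP szb]; case/lastP: bs szb okT => // bs [am Tm].
rewrite size_rcons => -[szb] okT; rewrite all_rcons => /andP[okm okb].
move=> /and3P[ys0 /eqP szc]; case: cs szc okU => // -[b0 U0] cs [szc] okU /= /andP[ok0 okc].
rewrite /last_edge /but_last last_rcons size_rcons -cats1 take_size_cat //.
case: o oO => [w|w|] oO.
- by apply: supported_graft_at; rewrite ?addn0 ?szb // tot // okU.
- by apply: supported_graft_at; rewrite ?szc // tot // cats1 okT.
- apply: supported_graft_at; rewrite ?size_cat ?szb ?szc ?addn_gt0 //.
    by rewrite xs0.
  exact: tot.
Qed.

Lemma supported_op o g h :
  in_Omega_op o -> g \in supported (@DT_tree X Omega) ->
  h \in supported (@DT_tree X Omega) ->
  bilin (op k o) g h \in supported (@DT_tree X Omega).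
Proof.
move=> oO Pg Ph; apply: supported_lin Pg => T DTT.
by apply: supported_lin Ph => U DTU; apply: supported_op_rec.
Qed.

Lemma DT_corolla (x : X) : DT_tree (corolla Omega x).
Proof.
by rewrite /DT_tree /corolla /= /edge_ok /=; case: asboolP.
Qed.

End Closure.

Section DTModule.
Variables (k : comPzRingType) (X : Type) (Omega : semigroupType).

Record DT : Type := MkDT {
  DT_val : free k (rtree X Omega);
  _ : DT_val \in supported (@DT_tree X Omega) }.

HB.instance Definition _ := [isSub for DT_val].
HB.instance Definition _ := [Choice of DT by <:].
HB.instance Definition _ := [SubChoice_isSubLmodule of DT by <:].

Definition DT_op (o : operation Omega) (oO : in_Omega_op o) (g h : DT) : DT :=
  MkDT (supported_op oO (valP g) (valP h)).

Definition DT_prec (w : Omega) : DT -> DT -> DT := @DT_op (Prec (InO w)) isT.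
Definition DT_succ (w : Omega) : DT -> DT -> DT := @DT_op (Succ (InO w)) isT.
Definition DT_dot : DT -> DT -> DT := @DT_op Dot isT.

Definition DT_corolla_basis (x : X) : DT :=
  MkDT (supported_basis k (DT_corolla Omega x)).

End DTModule.

Section TridendriformFamilyAlgebras.
Variables (k : comPzRingType) (Omega : semigroupType) (T : lmodType k).
Variables (prec succ : Omega -> T -> T -> T) (dot : T -> T -> T).

Definition bilinear_op (f : T -> T -> T) : Prop :=
  (forall x, linear (f x)) /\ (forall y, linear (f^~ y)).

Record is_tridendriform_family_algebra : Prop := {
  prec_bilinear : forall a, bilinear_op (prec a);
  succ_bilinear : forall a, bilinear_op (succ a);
  dot_bilinear : bilinear_op dot;
  tfa_prec_prec : forall x y z a b,
    prec b (prec a x y) z = prec (a * b)%g x (prec b y z + succ a y z + dot y z);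
  tfa_succ_prec : forall x y z a b,
    prec b (succ a x y) z = succ a x (prec b y z);
  tfa_succ_succ : forall x y z a b,
    succ (a * b)%g (prec b x y + succ a x y + dot x y) z = succ a x (succ b y z);
  tfa_succ_dot : forall x y z a, dot (succ a x y) z = succ a x (dot y z);
  tfa_prec_dot : forall x y z a, dot (prec a x y) z = dot x (succ a y z);
  tfa_dot_prec : forall x y z a, prec a (dot x y) z = dot x (prec a y z);
  tfa_dot_dot : forall x y z, dot (dot x y) z = dot x (dot y z)
}.

Local Open Scope classical_set_scope.

Record closed_submodule (D : set T) : Prop := {
  closed_zero : D 0;
  closed_linear : forall (c : k) x y, D x -> D y -> D (c *: x + y);
  closed_prec : forall w x y, D x -> D y -> D (prec w x y);
  closed_succ : forall w x y, D x -> D y -> D (succ w x y);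
  closed_dot : forall x y, D x -> D y -> D (dot x y)
}.

Definition generated_by (S : set T) : Prop :=
  smallest closed_submodule S = setT.

End TridendriformFamilyAlgebras.

(* Main.v *)
(** Put star_{a,b}(T, U) := T succ_a U + T prec_b U + T . U, with star(|, |) = |.
    For three trees other than |, the sum of the seven tridendriform family
    axioms is the associativity law
      star_{ab,c}(star_{a,b}(T, U), V) = star_{a,bc}(T, star_{b,c}(U, V)),
    in which | (with label 1) is a unit. The axioms (succ, prec), (succ, dot),
    (dot, prec) and (dot, dot) hold because the two operations rewrite distinct
    edges of a grafting; each of the other three reduces to the associativity law
    for subtrees. So associativity follows by induction on the total depth, and
    the axioms follow from it.
    The two-leaf trees generate because a binary grafting is
    (T succ_a corolla) prec_b U, and a grafting at a vertex decorated by
    x_1, ..., x_k is the dot product of the binary grafting of T_0 and | at x_1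
    with the grafting of T_1, ..., T_k at x_2, ..., x_k. *)
From HB Require Import structures.
From mathcomp Require Import all_boot all_algebra finmap.
From mathcomp Require Import boolp classical_sets.
From mathcomp Require Import monalg.
Require Import Defs.

Set Implicit Arguments.
Unset Strict Implicit.
Unset Printing Implicit Defensive.

Import GRing.Theory.

Local Open Scope classical_set_scope.

(** * Linear and bilinear extension of maps given on a basis *)

Section LinearExtension.
Local Open Scope ring_scope.
Variables (k : comPzRingType) (K : choiceType).
Implicit Types (M N : lmodType k) (g h : free k K).

Lemma lin_superset M (f : K -> M) g (d : {fset K}) :
  (msupp g `<=` d)%fset -> lin f g = \sum_(t <- d) g@_t *: f t.
Proof.
move=> le; rewrite /lin; apply: (big_fset_incl _ le) => t _ /mcoeff_outdom->.
by rewrite scale0r.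
Qed.

Lemma lin_is_linear M (f : K -> M) : linear (lin f).
Proof.
move=> c g h.
(* A common index set for the three supports, so that the sums can be added termwise. *)
pose d := (msupp (c *: g + h) `|` (msupp g `|` msupp h))%fset.
rewrite !(@lin_superset _ f _ d) /d.
- rewrite scaler_sumr -big_split; apply: eq_bigr => t _ /=.
  by rewrite mcoeffD fscaleE scalerDl scalerA.
- by rewrite fsubsetU // fsubsetUr orbT.
- by rewrite fsubsetU // fsubsetUl orbT.
- exact: fsubsetUl.
Qed.

HB.instance Definition _ M (f : K -> M) :=
  GRing.isLinear.Build k (free k K) M *:%R (lin f) (lin_is_linear f).

Lemma lin_basis M (f : K -> M) t : lin f (basis k t) = f t.
Proof.
(* Over the zero ring [basis k t] has empty support, so only inclusion in [[fset t]] is used. *)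
rewrite (@lin_superset _ _ _ [fset t]%fset) ?msuppU_le // big_seq_fset1 mcoeffUU.
exact: scale1r.
Qed.

Lemma eq_lin_in M (f f' : K -> M) (P : pred K) g :
  g \in supported P -> (forall t, P t -> f t = f' t) -> lin f g = lin f' g.
Proof.
move=> /allP Pg ff'; rewrite /lin big_seq [RHS]big_seq.
by apply: eq_bigr => t /Pg /ff' ->.
Qed.

Lemma eq_lin M (f f' : K -> M) g : f =1 f' -> lin f g = lin f' g.
Proof. by move=> ff'; apply: eq_bigr => t _; rewrite ff'. Qed.

Lemma linD M (f f' : K -> M) g :
  lin (fun t => f t + f' t) g = lin f g + lin f' g.
Proof. by rewrite /lin -big_split; apply: eq_bigr => t _; rewrite scalerDr. Qed.

Lemma lin_id g : lin (@basis k K) g = g.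
Proof.
rewrite [RHS]monalgE; apply: eq_bigr => t _; apply/malgP => u.
by rewrite fscaleE !mcoeffU mulr_natr.
Qed.

Lemma linear_lin M N (L : {linear M -> N}) (f : K -> M) g :
  L (lin f g) = lin (L \o f) g.
Proof.
by rewrite /lin linear_sum; apply: eq_bigr => t _; rewrite linearZ.
Qed.

End LinearExtension.

Section BilinearExtension.
Local Open Scope ring_scope.
Variables (k : comPzRingType) (K : choiceType).
Implicit Types (g h l : free k K) (M N : lmodType k).

Lemma lin_lin (K' : choiceType) M (f : K' -> M) (f' : K -> free k K') g :
  lin f (lin f' g) = lin (fun t => lin f (f' t)) g.
Proof. exact: linear_lin. Qed.

(** The coefficients commute in [k]. This gives linearity of [bilin] in its second argument and the
    interchange of independent graftings. *)
Lemma exchange_lin (K' : choiceType) M (f : K -> K' -> M) g (h : free k K') :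
  lin (fun t => lin (f t) h) g = lin (fun u => lin (f^~ u) g) h.
Proof.
rewrite /lin; under eq_bigr do rewrite scaler_sumr.
rewrite exchange_big; apply: eq_bigr => u _; rewrite scaler_sumr.
by apply: eq_bigr => t _; rewrite !scalerA mulrC.
Qed.

Lemma bilinear_bilin M (f : K -> K -> M) :
  (forall g, linear (bilin f g)) /\ (forall h, linear (bilin f ^~ h)).
Proof.
split=> g c h l; last exact: lin_is_linear.
have bilinE a : bilin f g a = lin (fun u => lin (f^~ u) g) a.
  exact: exchange_lin.
by rewrite !bilinE lin_is_linear.
Qed.

Lemma bilinD M (f f' : K -> K -> M) g h :
  bilin (fun t u => f t u + f' t u) g h = bilin f g h + bilin f' g h.
Proof. by rewrite -linD; apply: eq_lin => t; rewrite linD. Qed.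

(** Multilinearity reduces an axiom with two nested operations to basis elements satisfying [P]. *)
Lemma bilin_assoc (P : pred K) (f f' e e' : K -> K -> free k K) g h l :
  (forall t u v, P t -> P u -> P v ->
     lin (f^~ v) (f' t u) = lin (e t) (e' u v)) ->
  g \in supported P -> h \in supported P -> l \in supported P ->
  bilin f (bilin f' g h) l = bilin e g (bilin e' h l).
Proof.
move=> fe Pg Ph Pl; rewrite /bilin lin_lin.
apply: (eq_lin_in Pg) => t Pt; rewrite !lin_lin.
apply: (eq_lin_in Ph) => u Pu; rewrite exchange_lin lin_lin.
by apply: (eq_lin_in Pl) => v Pv; apply: fe.
Qed.

End BilinearExtension.

(** * Graftings of linear combinations, and [|] as a unit *)

Section SchroderTrees.
Local Open Scope ring_scope.
Variables (k : comPzRingType) (X : Type) (Omega : semigroupType).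
Local Notation tree := (rtree X Omega).
Local Notation edge := (unitization Omega * tree)%type.
Local Notation op := (@op k X Omega).
Local Notation star := (total op).
Implicit Types (T U V W : tree) (a b c : unitization Omega) (S : free k tree).

Lemma lin_graft_at (M : lmodType k) (f : tree -> M) xs (l r : seq edge) a S :
  lin f (graft_at xs l a S r) =
  lin (fun W => f (Graft xs (l ++ (a, W) :: r))) S.
Proof. by rewrite lin_lin; apply: eq_lin => W; rewrite lin_basis. Qed.

Lemma graft_at_lin (K : choiceType) xs (l r : seq edge) a (f : K -> free k tree)
    (S : free k K) :
  graft_at xs l a (lin f S) r = lin (fun t => graft_at xs l a (f t) r) S.
Proof. exact: lin_lin. Qed.

(** Insertions at two different edges of one vertex are independent. This settles the four axioms
    that need no induction. *)
Lemma exchange_graft_at zs (l m r : seq edge) a b S S' :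
  lin (fun W => graft_at zs (l ++ (a, W) :: m) b S r) S' =
  lin (fun W => graft_at zs l a S' (m ++ (b, W) :: r)) S.
Proof.
rewrite exchange_lin; apply: eq_lin => W.
by apply: eq_lin => W'; rewrite -catA.
Qed.

Lemma graft_at_nonleaf xs (l r : seq edge) a S :
  graft_at xs l a S r \in supported (predC (@is_leaf X Omega)).
Proof.
apply: (@supported_lin _ _ _ predT) => [W _|]; first exact: supported_basis.
by apply/allP.
Qed.

Lemma op_nonleaf o T U : op o T U \in supported (predC (@is_leaf X Omega)).
Proof.
case: T U => [|xs bs] [|ys cs]; first exact: rpred0.
- by case: o => *; rewrite ?rpred0 // supported_basis.
- case: o => *; rewrite ?prec_leaf ?succ_leaf ?dot_leaf //.
  + exact: supported_basis.
  + exact: rpred0.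
  + exact: rpred0.
- rewrite op_graft; case: last_edge => ? ?; case: first_edge => ? ?.
  by case: o => *; apply: graft_at_nonleaf.
Qed.

Lemma starE a T b U : ~~ (is_leaf T && is_leaf U) ->
  star a T b U = op (Succ a) T U + op (Prec b) T U + op Dot T U.
Proof. by move=> /negbTE TU; rewrite /total TU. Qed.

Lemma star_nonleaf a T b U : ~~ (is_leaf T && is_leaf U) ->
  star a T b U \in supported (predC (@is_leaf X Omega)).
Proof. by move=> TU; rewrite starE // !rpredD // op_nonleaf. Qed.

Lemma star_leaf a T : star a T one1 Leaf = basis k T.
Proof.
have [|Tl] := boolP (is_leaf T); first by case: T.
by rewrite starE ?andbF ?(negbTE Tl) // succ_leaf // prec_leaf // dot_leaf //
           add0r addr0.
Qed.

Lemma leaf_star T b : star one1 Leaf b T = basis k T.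
Proof.
have [|Tl] := boolP (is_leaf T); first by case: T.
by rewrite starE // leaf_succ // leaf_prec // leaf_dot // !addr0.
Qed.

Lemma ok_edge_leaf a : ok_edge (a, Leaf : tree) -> a = one1.
Proof. by rewrite /ok_edge /edge_ok /= andbT => /asboolP. Qed.

(** A vertex has arity at least two, so its first and last edges are distinct and can be modified
    separately; the depth bounds serve the induction. *)
Variant DT_tree_spec T : Prop :=
  DTTreeSpec xs a0 T0 bs am Tm of
    T = Graft xs ((a0, T0) :: rcons bs (am, Tm)) &
    ok_edge (a0, T0) & ok_edge (am, Tm) &
    (depth T0 < depth T)%N & (depth Tm < depth T)%N.

Lemma DT_treeP T : DT_tree T -> DT_tree_spec T.
Proof.
rewrite DT_treeE; case: T => [|xs bs]; first by rewrite andbF.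
rewrite andbT => /and3P[xs0 /eqP szb okb].
case: bs szb okb => // -[a0 T0] bs.
case/lastP: bs => [[szx]|bs [am Tm] _]; first by rewrite -szx in xs0.
rewrite /= all_rcons => /and3P[ok0 okm _]; exists xs a0 T0 bs am Tm => //.
  exact: (depth_first xs ((a0, T0) :: rcons bs (am, Tm))).
have := depth_last xs ((a0, T0) :: rcons bs (am, Tm)).
by rewrite /last_edge /= last_rcons.
Qed.

Definition star_assoc_at a T b U c V : Prop :=
  lin (fun W => star (mul1 a b) W c V) (star a T b U) =
  lin (star a T (mul1 b c)) (star b U c V).

(** The induction hypothesis. It admits [|] with label 1, since the subtrees it is applied to may be
    leaves. *)
Definition star_assoc_below (n : nat) : Prop := forall a T b U c V,
  (depth T + depth U + depth V < n)%N ->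
  ok_edge (a, T) -> ok_edge (b, U) -> ok_edge (c, V) ->
  star_assoc_at a T b U c V.

(** * The seven axioms on trees *)

Section TreeIdentities.
Variables (T U V : tree) (a b c : unitization Omega).
Hypotheses (DT_T : DT_tree T) (DT_U : DT_tree U) (DT_V : DT_tree V).

Let Tn : ~~ is_leaf T. Proof. by move: DT_T; rewrite DT_treeE => /andP[]. Qed.
Let Un : ~~ is_leaf U. Proof. by move: DT_U; rewrite DT_treeE => /andP[]. Qed.
Let Vn : ~~ is_leaf V. Proof. by move: DT_V; rewrite DT_treeE => /andP[]. Qed.

Lemma succ_prec :
  lin (fun W => op (Prec b) W V) (op (Succ a) T U) =
  lin (op (Succ a) T) (op (Prec b) U V).
Proof.
case: (DT_treeP DT_U) => ys b0 U0 cs bn Un' -> _ _ _ _.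
rewrite succ_graft // -rcons_cons prec_graft // !lin_graft_at /=.
under eq_lin do rewrite -rcons_cons prec_graft //.
under [RHS]eq_lin do rewrite succ_graft //.
exact: (exchange_graft_at _ [::]).
Qed.

Lemma succ_dot :
  lin (fun W => op Dot W V) (op (Succ a) T U) =
  lin (op (Succ a) T) (op Dot U V).
Proof.
case: (DT_treeP DT_U) => ys b0 U0 cs bn Un' -> _ _ _ _.
case: (DT_treeP DT_V) => zs c0 V0 ds cn Vn' -> _ _ _ _.
move: (rcons ds _) => {cn Vn'}ds.
rewrite succ_graft // -rcons_cons dot_graft // !lin_graft_at /=.
under eq_lin do rewrite -rcons_cons dot_graft //.
under [RHS]eq_lin do rewrite succ_graft //.
exact: (exchange_graft_at _ [::]).
Qed.

Lemma dot_prec :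
  lin (fun W => op (Prec b) W V) (op Dot T U) =
  lin (op Dot T) (op (Prec b) U V).
Proof.
case: (DT_treeP DT_T) => xs a0 T0 bs am Tm -> _ _ _ _.
case: (DT_treeP DT_U) => ys b0 U0 cs bn Un' -> _ _ _ _.
rewrite -(rcons_cons (a0, T0)) dot_graft -rcons_cons prec_graft // !lin_graft_at.
under eq_lin do rewrite -rcons_cons -rcons_cat prec_graft //.
under [RHS]eq_lin do rewrite dot_graft.
exact: exchange_graft_at.
Qed.

Lemma dot_dot :
  lin (fun W => op Dot W V) (op Dot T U) = lin (op Dot T) (op Dot U V).
Proof.
case: (DT_treeP DT_T) => xs a0 T0 bs am Tm -> _ _ _ _.
case: (DT_treeP DT_U) => ys b0 U0 cs bn Un' -> _ _ _ _.
case: (DT_treeP DT_V) => zs c0 V0 ds cn Vn' -> _ _ _ _.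
move: (rcons ds _) => {cn Vn'}ds.
rewrite -(rcons_cons (a0, T0)) dot_graft -rcons_cons dot_graft // !lin_graft_at.
under eq_lin do rewrite -rcons_cons -rcons_cat dot_graft -catA.
under [RHS]eq_lin do rewrite dot_graft.
exact: exchange_graft_at.
Qed.

Hypothesis assoc : star_assoc_below (depth T + depth U + depth V).

(** Both sides change only the last subtree [Tm] of [T], which leaves associativity for [Tm], [U],
    [V]; the labels agree by [mul1A]. *)
Lemma prec_prec : ok_edge (a, U) -> ok_edge (b, V) ->
  lin (fun W => op (Prec b) W V) (op (Prec a) T U) =
  lin (op (Prec (mul1 a b)) T) (star a U b V).
Proof.
move=> okU okV; case: (DT_treeP DT_T) assoc => xs a0 T0 bs am Tm -> _ okm _ lt asc.
rewrite -(rcons_cons (a0, T0)) prec_graft // lin_graft_at.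
under eq_lin do rewrite cats1 prec_graft //.
have UV : ~~ (is_leaf U && is_leaf V) by rewrite negb_and Un.
rewrite -graft_at_lin asc ?ltn_add2r //.
(* [prec_graft] excludes [|], on which [T prec | = T] keeps the old label; as [U] is not [|], no
   leaf occurs in [star a U b V]. *)
rewrite graft_at_lin -mul1A; apply: (eq_lin_in (star_nonleaf _ _ UV)) => W Wn.
by rewrite prec_graft.
Qed.

(** The mirror image: associativity for [T], [U] and the first subtree [V0] of [V]. *)
Lemma succ_succ : ok_edge (a, T) -> ok_edge (b, U) ->
  lin (fun W => op (Succ (mul1 a b)) W V) (star a T b U) =
  lin (op (Succ a) T) (op (Succ b) U V).
Proof.
move=> okT okU; case: (DT_treeP DT_V) assoc => zs c0 V0 ds cn Vn' -> ok0 _ lt _ asc.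
rewrite succ_graft // lin_graft_at /=.
under [RHS]eq_lin do rewrite succ_graft //.
rewrite -graft_at_lin -asc ?ltn_add2l //.
have TU : ~~ (is_leaf T && is_leaf U) by rewrite negb_and Tn.
rewrite graft_at_lin mul1A; apply: (eq_lin_in (star_nonleaf _ _ TU)) => W Wn.
by rewrite succ_graft.
Qed.

(** Both sides merge the root vertices of [T] and [V]; only the middle subtree is in question, and
    there associativity for [Tm], [U], [V0] applies. *)
Lemma prec_dot : ok_edge (b, U) ->
  lin (fun W => op Dot W V) (op (Prec b) T U) =
  lin (op Dot T) (op (Succ b) U V).
Proof.
move=> okU.
case: (DT_treeP DT_T) assoc => xs a0 T0 bs am Tm -> _ okm _ ltT.
case: (DT_treeP DT_V) => zs c0 V0 ds cn Vn' -> ok0 _ ltV _ asc.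
rewrite -(rcons_cons (a0, T0)) prec_graft // succ_graft // !lin_graft_at /=.
under eq_lin do rewrite cats1 -(rcons_cons (a0, T0)) dot_graft.
under [RHS]eq_lin do rewrite -(rcons_cons (a0, T0)) dot_graft.
rewrite -!graft_at_lin asc ?mul1A //.
by rewrite -addSn leq_add ?ltn_add2r ?(ltnW ltV).
Qed.

End TreeIdentities.

(** * Associativity by induction, and the axioms on [DT] *)

Lemma star_assoc a T b U c V :
  ok_edge (a, T) -> ok_edge (b, U) -> ok_edge (c, V) ->
  star_assoc_at a T b U c V.
Proof.
suff all_n n : star_assoc_below n by apply: (all_n (depth T + depth U + depth V).+1).
elim: n => // n IHn {}a {}T {}b {}U {}c {}V ltn okT okU okV.
have {}IHn : star_assoc_below (depth T + depth U + depth V).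
  by move=> ? ? ? ? ? ? lt; apply: IHn; apply: leq_trans lt ltn.
rewrite /star_assoc_at.
have [Tl|Tn] := boolP (is_leaf T).
  case: T Tl okT {ltn IHn} => // _ /ok_edge_leaf ->.
  by rewrite leaf_star lin_basis mul1o; under eq_lin do rewrite leaf_star; rewrite lin_id.
have [Vl|Vn] := boolP (is_leaf V).
  case: V Vl okV {ltn IHn} => // _ /ok_edge_leaf ->.
  by rewrite star_leaf lin_basis mulo1; under eq_lin do rewrite star_leaf; rewrite lin_id.
have [Ul|Un] := boolP (is_leaf U).
  case: U Ul okU {ltn IHn} => // _ /ok_edge_leaf ->.
  by rewrite star_leaf leaf_star !lin_basis mul1o mulo1.
have DTw e W : ~~ is_leaf W -> ok_edge (e, W) -> DT_tree W.
  by move=> Wn /andP[_ wW]; rewrite DT_treeE wW.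
have DTT := DTw _ _ Tn okT; have DTU := DTw _ _ Un okU; have DTV := DTw _ _ Vn okV.
under eq_lin do rewrite starE ?(negbTE Vn) ?andbF //.
under [RHS]eq_lin do rewrite starE ?(negbTE Tn) //.
(* These two rewrites remove the inner [star] of one summand on each side; expanding the others
   leaves seven terms per side, matched by the remaining five identities. *)
rewrite !linD succ_succ // -prec_prec //.
rewrite !starE ?(negbTE Tn) ?(negbTE Un) // !linearD /=.
rewrite succ_prec // dot_prec // succ_dot // prec_dot // dot_dot //.
rewrite -!addrA [in RHS](addrCA (lin _ (op Dot U V))); do 3!congr (_ + _).
by rewrite addrCA; congr (_ + _); rewrite addrCA.
Qed.

Lemma bilin_star a b (g h : free k tree) :
  g \in supported (@DT_tree X Omega) -> h \in supported (@DT_tree X Omega) ->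
  bilin (fun T U => star a T b U) g h =
  bilin (op (Prec b)) g h + bilin (op (Succ a)) g h + bilin (op Dot) g h.
Proof.
move=> Pg Ph; rewrite -!bilinD.
apply: (eq_lin_in Pg) => T; rewrite DT_treeE => /andP[_ /negbTE Tn].
by apply: eq_lin => U; rewrite starE ?Tn // [op (Prec b) T U + _]addrC.
Qed.

Lemma DT_op_bilinear o (oO : in_Omega_op o) : bilinear_op (@DT_op k X Omega o oO).
Proof.
have [linr linl] := bilinear_bilin (op o).
split=> [x|y] c g h; apply: val_inj.
  exact: (linr (val x) c (val g) (val h)).
exact: (linl (val y) c (val g) (val h)).
Qed.

Lemma DT_tridendriform :
  is_tridendriform_family_algebra
    (@DT_prec k X Omega) (@DT_succ k X Omega) (@DT_dot k X Omega).
Proof.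
have below T U V : star_assoc_below (depth T + depth U + depth V).
  by move=> *; apply: star_assoc.
split=> [a|a||x y z a b|x y z a b|x y z a b|x y z a|x y z a|x y z a|x y z];
  do ?[exact: DT_op_bilinear]; apply: val_inj; case: x y z => [x Px] [y Py] [z Pz] /=.
- rewrite -bilin_star //; apply: bilin_assoc Px Py Pz => T U V DT_T DT_U DT_V.
  by rewrite prec_prec ?ok_edge_DT.
- by apply: bilin_assoc Px Py Pz => T U V *; apply: succ_prec.
- rewrite -bilin_star //; apply: bilin_assoc Px Py Pz => T U V DT_T DT_U DT_V.
  by rewrite -succ_succ ?ok_edge_DT.
- by apply: bilin_assoc Px Py Pz => T U V *; apply: succ_dot.
- apply: bilin_assoc Px Py Pz => T U V DT_T DT_U DT_V.
  by apply: prec_dot; rewrite ?ok_edge_DT.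
- by apply: bilin_assoc Px Py Pz => T U V *; apply: dot_prec.
- by apply: bilin_assoc Px Py Pz => T U V *; apply: dot_dot.
Qed.

(** * Generation by the trees with two leaves *)

Section Generation.
Variable D : set (DT k X Omega).
Hypothesis D_closed :
  closed_submodule (@DT_prec k X Omega) (@DT_succ k X Omega) (@DT_dot k X Omega) D.
Hypothesis D_corolla : range (@DT_corolla_basis k X Omega) `<=` D.

(** Quantifying over [g] avoids carrying a proof that [T] lies in [DT_tree]. *)
Let basis_in T : Prop := forall g : DT k X Omega, val g = basis k T -> D g.

Lemma basis_in_corolla x : basis_in (corolla Omega x).
Proof.
by move=> g gx; apply: D_corolla; exists x => //; apply: val_inj; rewrite gx.
Qed.

Lemma basis_in_op o T U W :
  in_Omega_op o -> DT_tree T -> DT_tree U -> op o T U = basis k W ->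
  basis_in T -> basis_in U -> basis_in W.
Proof.
move=> oO DT_T DT_U TU D_T D_U g gW.
pose t : DT k X Omega := MkDT (supported_basis k DT_T).
pose u : DT k X Omega := MkDT (supported_basis k DT_U).
have -> : g = DT_op oO t u.
  by apply: val_inj; rewrite gW -TU /= /bilin !lin_basis.
have Dt : D t by exact: D_T.
have Du : D u by exact: D_U.
case: D_closed => _ _ Dprec Dsucc Ddot.
(* [in_Omega_op] rules out the adjoined unit as an index, which leaves the operations preserving
   [D]. *)
case: o oO {TU} => [[w|//]|[w|//]|] oO; rewrite (bool_irrelevance oO isT).
- exact: Dprec.
- exact: Dsucc.
- exact: Ddot.
Qed.

Lemma DT_binary x (e f : edge) :
  ok_edge e -> ok_edge f -> DT_tree (Graft [:: x] [:: e; f]).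
Proof.
by rewrite DT_treeE /ok_edge => e_ok f_ok; rewrite /= e_ok f_ok.
Qed.

Lemma ok_edge_unit : ok_edge (one1, Leaf : tree).
Proof. by rewrite /ok_edge /edge_ok /= andbT; apply/asboolP. Qed.

Lemma ok_edgeP a T : ok_edge (a, T) ->
  (a = one1 /\ T = Leaf) \/ (inO a /\ DT_tree T).
Proof.
case: T => [|xs bs] ok; first by left; rewrite (ok_edge_leaf ok).
by right; rewrite DT_treeE andbT; apply/andP.
Qed.

(** [T succ_a corolla] replaces the left leaf by [T], with label [a 1 = a]. The index must lie in
    [Omega], so [T = |] is treated apart. *)
Lemma basis_in_binary_l x a T :
  ok_edge (a, T) -> (DT_tree T -> basis_in T) ->
  basis_in (Graft [:: x] [:: (a, T); (one1, Leaf)]).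
Proof.
move=> /ok_edgeP[[-> ->] _|[aO DT_T] D_T]; first exact: basis_in_corolla.
apply: (@basis_in_op (Succ a) T (corolla Omega x)); rewrite ?DT_corolla //.
- rewrite succ_graft; last by move: DT_T; rewrite DT_treeE => /andP[].
  by rewrite mulo1 star_leaf /graft_at lin_basis.
- exact: D_T.
- exact: basis_in_corolla.
Qed.

Lemma basis_in_binary x a T b U :
  ok_edge (a, T) -> ok_edge (b, U) ->
  (DT_tree T -> basis_in T) -> (DT_tree U -> basis_in U) ->
  basis_in (Graft [:: x] [:: (a, T); (b, U)]).
Proof.
move=> okT okU D_T; have D_l := basis_in_binary_l (x := x) okT D_T.
case/ok_edgeP: okU => [[-> ->] //|[bO DT_U] D_U].
apply: (@basis_in_op (Prec b) _ U _ _ _ _ _ D_l (D_U DT_U)) => //.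
  exact: DT_binary okT ok_edge_unit.
rewrite (@prec_graft _ _ _ _ _ [:: (a, T)]).
  by rewrite mul1o leaf_star /graft_at lin_basis.
by move: DT_U; rewrite DT_treeE => /andP[].
Qed.

Lemma basis_in_graft xs (bs : seq edge) :
  foldr (fun e Q => (DT_tree e.2 -> basis_in e.2) /\ Q) True bs ->
  DT_tree (Graft xs bs) -> basis_in (Graft xs bs).
Proof.
rewrite DT_treeE andbT; elim: xs bs => [|x xs IHxs] bs //=.
case: bs => [|[a T] [|[b U] bs]] //= [D_T [D_U D_bs]].
rewrite eqSS => /andP[szb /and3P[okT okU okbs]].
case: xs IHxs szb => [|y xs] IHxs szb.
  by case: bs szb {D_bs okbs} => // _; apply: basis_in_binary.
have DT_r : DT_tree (Graft (y :: xs) ((b, U) :: bs)).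
  by rewrite DT_treeE andbT /= eqSS in szb *; rewrite szb okU.
apply: (@basis_in_op Dot (Graft [:: x] (rcons [:: (a, T)] (one1, Leaf)))
                         (Graft (y :: xs) ((b, U) :: bs))) => //.
- exact: DT_binary okT ok_edge_unit.
(* The right leaf of the binary tree is absorbed by [U]: [|] is a unit for [star] and [1 b = b]. *)
- by rewrite dot_graft mul1o leaf_star /graft_at lin_basis.
- exact: basis_in_binary_l.
- apply: IHxs => //.
  by move: DT_r; rewrite DT_treeE andbT.
Qed.

Lemma basis_in_DT_tree T : DT_tree T -> basis_in T.
Proof. by elim/rtree_nested_ind: T => // xs bs IH; apply: basis_in_graft. Qed.

Lemma closed_submodule_full (g : DT k X Omega) : D g.
Proof.
(* The list [s] and coefficients [c] are arbitrary, so that the tail of the sum is again covered by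
   the induction. *)
have sum_in (c : tree -> k) (s : seq tree) (h : DT k X Omega) :
    all (@DT_tree X Omega) s -> val h = \sum_(t <- s) c t *: basis k t -> D h.
  case: D_closed => D0 Dlin _ _ _.
  elim: s h => [|t s IHs] h /=.
    by rewrite big_nil => _ h0; have -> : h = 0 by apply: val_inj.
  case/andP=> DT_t DT_s; rewrite big_cons => hE.
  have Ps : \sum_(u <- s) c u *: basis k u \in supported (@DT_tree X Omega).
    rewrite big_seq rpred_sum // => u us; rewrite rpredZ // supported_basis //.
    exact: allP us.
  have -> : h = c t *: MkDT (supported_basis k DT_t) + MkDT Ps by exact: val_inj.
  by apply: Dlin; [apply: (basis_in_DT_tree DT_t) | apply: (IHs _ DT_s)].
apply: (sum_in (fun t => (val g)@_t) (msupp (val g))); first exact: (valP g).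
by rewrite -[LHS]lin_id.
Qed.

End Generation.

End SchroderTrees.

Theorem proposition4p8 (k : comPzRingType) (X : Type) (Omega : semigroupType) :
  is_tridendriform_family_algebra
    (@DT_prec k X Omega) (@DT_succ k X Omega) (@DT_dot k X Omega) /\
  generated_by
    (@DT_prec k X Omega) (@DT_succ k X Omega) (@DT_dot k X Omega)
    (range (@DT_corolla_basis k X Omega)).
Proof.
split; first exact: DT_tridendriform.
(* [smallest] is the intersection of all closed [D] containing the generators, and each such [D] is
   everything. *)
by apply/seteqP; split=> // g _ D [D_closed D_corolla]; apply: closed_submodule_full.
Qed.
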